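(* Let $E$ be a hyperarithmetic equivalence relation on $\mathbb N$. Then $E<E^+$, i.e. $E\leq E^+$ and $E^+\not\leq E$.
   Context: For equivalence relations $E,F$ on $\mathbb N$, $E\leq F$ ($E$ is computably reducible to $F$) means there is a total computable $f\colon\mathbb N\to\mathbb N$ with $n\mathrel{E}n'\iff f(n)\mathrel{F}f(n')$ for all $n,n'$; $E<F$ means $E\leq F$ and $F\not\leq E$. $\phi_e$ denotes the $e$-th partial computable function. The computable FS-jump of $E$ is the equivalence relation $E^+$ on $\mathbb N$ defined by $e\mathrel{E^+}e'$ iff $\{[\phi_e(n)]_E:n\in\mathbb N,\ \phi_e(n)\downarrow\}=\{[\phi_{e'}(n)]_E:n\in\mathbb N,\ \phi_{e'}(n)\downarrow\}$. $E$ is hyperarithmetic if $E$, as a set of (codes of) pairs, is a hyperarithmetic set. *)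

(* Defs.v *)
(* Stdlib only.  The library has no computability theory, so oracle
   computation, a Goedel numbering, Kleene's O and the H-sets are set up
   here. *)
From Stdlib Require Import Arith Lia RelationClasses.
From Stdlib Require Cantor.

Definition npair (x y : nat) : nat := Cantor.to_nat (x, y).

(* Kleene's mu-recursive functions relative to an oracle, as unary functions
   on nat, with tuples coded by the Cantor pairing. *)
Inductive code : Set :=
| Zero | Succ | Fst | Snd | Oracle
| Pair (c d : code)
| Comp (c d : code)
| Prec (c d : code)
| Min (c : code).

Definition char (A : nat -> Prop) (x y : nat) : Prop :=
  (A x /\ y = 1) \/ (~ A x /\ y = 0).

(* [eval A c x y]: with oracle A, program c on input x halts with output y.
   [Prec c d] computes h with h<x,0> = c(x) and h<x,n+1> = d<x,<n,h<x,n>>>.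
   [Min c] sends x to the least n with c<x,n> = 0, provided that c<x,m> is
   defined for all m < n. *)
Inductive eval (A : nat -> Prop) : code -> nat -> nat -> Prop :=
| eval_zero x : eval A Zero x 0
| eval_succ x : eval A Succ x (S x)
| eval_fst x y : eval A Fst (npair x y) x
| eval_snd x y : eval A Snd (npair x y) y
| eval_oracle x y : char A x y -> eval A Oracle x y
| eval_pair c d x y z :
    eval A c x y -> eval A d x z -> eval A (Pair c d) x (npair y z)
| eval_comp c d x y z :
    eval A d x y -> eval A c y z -> eval A (Comp c d) x z
| eval_prec0 c d x y :
    eval A c x y -> eval A (Prec c d) (npair x 0) y
| eval_precS c d x n y z :
    eval A (Prec c d) (npair x n) y ->
    eval A d (npair x (npair n y)) z ->
    eval A (Prec c d) (npair x (S n)) z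
| eval_min c x n :
    eval A c (npair x n) 0 ->
    (forall m, m < n -> exists y, eval A c (npair x m) (S y)) ->
    eval A (Min c) x n.

Fixpoint encode (c : code) : nat :=
  match c with
  | Zero => 0
  | Succ => 1
  | Fst => 2
  | Snd => 3
  | Oracle => 4
  | Pair c d => 5 + 4 * npair (encode c) (encode d)
  | Comp c d => 6 + 4 * npair (encode c) (encode d)
  | Prec c d => 7 + 4 * npair (encode c) (encode d)
  | Min c => 8 + 4 * encode c
  end.

(* Graph of the e-th partial function computable relative to A. *)
Definition Phi (A : nat -> Prop) (e x y : nat) : Prop :=
  exists c, encode c = e /\ eval A c x y.

Definition phi (e x y : nat) : Prop := Phi (fun _ => False) e x y.

Lemma npair_inj x y x' y' : npair x y = npair x' y' -> x = x' /\ y = y'.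
Proof.
unfold npair; intros H; apply Cantor.to_nat_inj in H; now injection H.
Qed.

Lemma encode_inj c c' : encode c = encode c' -> c = c'.
Proof.
revert c'; induction c; intros [| | | | | | | | ] H; cbn -[Nat.mul npair] in H;
  try reflexivity; try lia.
1-3: match goal with
     | |- _ ?a ?b = _ ?a' ?b' =>
       assert (K : npair (encode a) (encode b) = npair (encode a') (encode b'))
         by lia;
       apply npair_inj in K; destruct K; f_equal; auto
     end.
f_equal; apply IHc; lia.
Qed.

Lemma eval_prec_inv A c d x n z :
  eval A (Prec c d) (npair x n) z ->
  match n with
  | 0 => eval A c x z
  | S m => exists y, eval A (Prec c d) (npair x m) y /\
                     eval A d (npair x (npair m y)) z
  end.
Proof.
intros H; remember (Prec c d) as p eqn:Hp; remember (npair x n) as i eqn:Hi.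
destruct H; try discriminate; injection Hp as -> ->;
  apply npair_inj in Hi as [<- <-]; eauto.
Qed.

Lemma eval_fun A c x y z : eval A c x y -> eval A c x z -> y = z.
Proof.
revert x y z; induction c as [| | | | | c IHc d IHd | c IHc d IHd
  | c IHc d IHd | c IHc]; intros x y z Hy Hz.
8: {
  enough (G : forall n u v w, eval A (Prec c d) (npair u n) v ->
      eval A (Prec c d) (npair u n) w -> v = w)
    by (inversion Hy; subst; eapply G; eassumption).
  clear x y z Hy Hz.
  induction n as [|n IHn]; intros u v w Hv Hw;
    apply eval_prec_inv in Hv, Hw; [eapply IHc; eassumption |].
  destruct Hv as [p [Hp Hv]], Hw as [q [Hq Hw]].
  assert (p = q) by (eapply IHn; eassumption); subst.
  eapply IHd; eassumption. }
all: inversion Hy; inversion Hz; subst;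
  repeat match goal with
  | H : npair _ _ = npair _ _ |- _ => apply npair_inj in H; destruct H; subst
  end; try reflexivity.
- unfold char in *; intuition congruence.
- f_equal; [eapply IHc | eapply IHd]; eassumption.
- match goal with
  | H1 : eval A d x ?v, H2 : eval A d x ?w |- _ =>
    assert (v = w) by (eapply IHd; eassumption); subst
  end; eapply IHc; eassumption.
- destruct (Nat.lt_trichotomy y z) as [L | [L | L]]; trivial; exfalso;
  match goal with
  | H : forall m, m < ?u -> _, L : _ < ?u |- _ => destruct (H _ L) as [v Hv]
  end; enough (0 = S v) by discriminate;
  (eapply IHc; [| exact Hv]; assumption).
Qed.

Lemma Phi_fun A e x y z : Phi A e x y -> Phi A e x z -> y = z.
Proof.
intros [c [<- H]] [c' [Hc H']]; apply encode_inj in Hc; subst.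
eapply eval_fun; eassumption.
Qed.

Definition computable (f : nat -> nat) : Prop :=
  exists e, forall n, phi e n (f n).

Definition turing_reducible (A B : nat -> Prop) : Prop :=
  exists e, forall x y, char A x y -> Phi B e x y.

Definition turing_jump (A : nat -> Prop) : nat -> Prop :=
  fun e => exists y, Phi A e e y.

Inductive kleeneO : nat -> Prop :=
| O_one : kleeneO 1
| O_succ a : kleeneO a -> kleeneO (2 ^ a)
| O_lim e (f : nat -> nat) :
    (forall n, phi e n (f n)) ->
    (forall n, kleeneO (f n)) ->
    (forall n, ltO (f n) (f (S n))) ->
    kleeneO (3 * 5 ^ e)
with ltO : nat -> nat -> Prop :=
| ltO_succ a : kleeneO a -> ltO a (2 ^ a)
| ltO_lim e n b : kleeneO (3 * 5 ^ e) -> phi e n b -> ltO b (3 * 5 ^ e)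
| ltO_trans a b c : ltO a b -> ltO b c -> ltO a c.

(* [Hset a X]: X is the H-set H_a.  It is a relation rather than a function of
   a because H_{2^a} depends negatively on H_a; for a in O it determines X up
   to extensional equality.  At limits,
   H_{3 5^e} = { <x,n> : x in H_{phi_e(n)} }. *)
Inductive Hset : nat -> (nat -> Prop) -> Prop :=
| H_one : Hset 1 (fun _ => False)
| H_succ a X : Hset a X -> Hset (2 ^ a) (turing_jump X)
| H_lim e (f : nat -> nat) (X : nat -> nat -> Prop) :
    (forall n, phi e n (f n)) ->
    (forall n, Hset (f n) (X n)) ->
    Hset (3 * 5 ^ e) (fun m => let (x, n) := Cantor.of_nat m in X n x).

Definition hyperarithmetic (A : nat -> Prop) : Prop :=
  exists a X, kleeneO a /\ Hset a X /\ turing_reducible A X.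

Definition hyperarithmetic_rel (E : nat -> nat -> Prop) : Prop :=
  hyperarithmetic (fun m => let (x, y) := Cantor.of_nat m in E x y).

Definition reducible (E F : nat -> nat -> Prop) : Prop :=
  exists f, computable f /\ forall n n', E n n' <-> F (f n) (f n').

Definition strictly_reducible (E F : nat -> nat -> Prop) : Prop :=
  reducible E F /\ ~ reducible F E.

(* The set { [phi_e(n)]_E : phi_e(n) halts } of E-classes, where subsets of
   nat are compared extensionally. *)
Definition class_range (E : nat -> nat -> Prop) (e : nat) :
    (nat -> Prop) -> Prop :=
  fun C => exists n y, phi e n y /\ forall z, C z <-> E y z.

Definition FSjump (E : nat -> nat -> Prop) : nat -> nat -> Prop :=
  fun e e' => forall C, class_range E e C <-> class_range E e' C.

(* Main.v *)
(* E <= E^+ is witnessed by n |-> an index of the constant function n.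

   Suppose f reduces E^+ to E.  Then E absorbs infinitary propositional logic:
   if the truth values of formulas s_n are given by "T(s_n) E delta", then
   "for all n" and "for some n" compare two sets of E-classes that are
   enumerated uniformly in the indices, and f turns such a comparison back into
   an instance of E.  Without negation in E^+, each formula is carried together
   with its negation.  The recursion theorem extends T to computable infinitary
   formulas; as T only has to be right on the well-founded ones, the notations
   in Kleene's O and the computations relative to H-sets can be unfolded
   naively, guessing every intermediate value.  So every H-set, of any level,
   reduces to E uniformly.  If E <=_T H_a, then the jump of H_a is computable in
   H_a, a contradiction. *)
Require Import Defs.
From Stdlib Require Import RelationClasses.
From Stdlib Require Import Arith Lia Classical.
From Stdlib Require Cantor.

(** * Functions computable uniformly in the oracle *)

Definition pi1 (n : nat) : nat := fst (Cantor.of_nat n).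
Definition pi2 (n : nat) : nat := snd (Cantor.of_nat n).

Lemma pi1_npair x y : pi1 (npair x y) = x.
Proof. unfold pi1, npair; now rewrite Cantor.cancel_of_to. Qed.

Lemma pi2_npair x y : pi2 (npair x y) = y.
Proof. unfold pi2, npair; now rewrite Cantor.cancel_of_to. Qed.

Lemma npair_pi n : npair (pi1 n) (pi2 n) = n.
Proof.
unfold npair, pi1, pi2; rewrite <- surjective_pairing.
apply Cantor.cancel_to_of.
Qed.

(** One code serves all oracles: it provides [phi]-indices and also runs inside computations
    relative to an H-set. *)
Definition rec (f : nat -> nat) : Prop :=
  exists c, forall A x, eval A c x (f x).

Ltac unpair := repeat rewrite ?pi1_npair, ?pi2_npair.
Tactic Notation "unpair" "in" hyp(H) :=
  repeat rewrite ?pi1_npair, ?pi2_npair in H.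

Lemma rec_ext f g : (forall x, f x = g x) -> rec f -> rec g.
Proof. intros H [c Hc]; exists c; intros A x; rewrite <- H; apply Hc. Qed.

Lemma rec_computable f : rec f -> computable f.
Proof. intros [c Hc]; exists (encode c); intros n; exists c; auto. Qed.

Fixpoint const_code (n : nat) : code :=
  match n with 0 => Zero | S m => Comp Succ (const_code m) end.

Definition id_code : code := Pair Fst Snd.

Lemma eval_const A n x : eval A (const_code n) x n.
Proof. induction n; simpl; econstructor; eauto using eval. Qed.

Lemma eval_Fst A x : eval A Fst x (pi1 x).
Proof. rewrite <- (npair_pi x) at 1; constructor. Qed.

Lemma eval_Snd A x : eval A Snd x (pi2 x).
Proof. rewrite <- (npair_pi x) at 1; constructor. Qed.

Lemma eval_id A x : eval A id_code x x.
Proof.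
rewrite <- (npair_pi x) at 2; constructor; [apply eval_Fst | apply eval_Snd].
Qed.

Lemma rec_const n : rec (fun _ => n).
Proof. exists (const_code n); intros; apply eval_const. Qed.

Lemma rec_id : rec (fun x => x).
Proof. exists id_code; intros; apply eval_id. Qed.

Lemma rec_comp f g : rec f -> rec g -> rec (fun x => f (g x)).
Proof.
intros [c Hc] [d Hd]; exists (Comp c d); intros A x; econstructor; eauto.
Qed.

Lemma rec_succ f : rec f -> rec (fun x => S (f x)).
Proof. apply rec_comp; exists Succ; constructor. Qed.

Lemma rec_pi1 f : rec f -> rec (fun x => pi1 (f x)).
Proof. apply rec_comp; exists Fst; apply eval_Fst. Qed.

Lemma rec_pi2 f : rec f -> rec (fun x => pi2 (f x)).
Proof. apply rec_comp; exists Snd; apply eval_Snd. Qed.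

Lemma rec_npair f g : rec f -> rec g -> rec (fun x => npair (f x) (g x)).
Proof.
intros [c Hc] [d Hd]; exists (Pair c d); intros A x; constructor; auto.
Qed.

Lemma rec_nat_rect (a : nat -> nat) (step : nat -> nat -> nat -> nat)
    (n : nat -> nat) :
  rec a -> rec (fun p => step (pi1 p) (pi1 (pi2 p)) (pi2 (pi2 p))) -> rec n ->
  rec (fun x => nat_rect (fun _ => nat) (a x) (step x) (n x)).
Proof.
intros [c Hc] [d Hd] Hn.
enough (H : rec (fun p => nat_rect (fun _ => nat) (a (pi1 p)) (step (pi1 p))
                            (pi2 p))).
{ apply (rec_comp _ (fun x => npair x (n x))) in H;
    [| now apply rec_npair; [apply rec_id |]].
  revert H; apply rec_ext; intros x; now rewrite pi1_npair, pi2_npair. }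
exists (Prec c d); intros A p; rewrite <- (npair_pi p) at 1.
generalize (pi1 p) (pi2 p); clear p; intros x m.
induction m as [|m IH]; simpl; [constructor; apply Hc |].
econstructor; [exact IH |].
specialize (Hd A (npair x (npair m
  (nat_rect (fun _ : nat => nat) (a x) (step x) m)))).
now rewrite !pi2_npair, !pi1_npair in Hd.
Qed.

Ltac rec_tac0 :=
  match goal with
  | |- rec (fun x => x) => apply rec_id
  | |- rec (fun _ => ?c) => apply (rec_const c)
  | |- rec (fun x => S (@?f x)) => apply (rec_succ f)
  | |- rec (fun x => pi1 (@?f x)) => apply (rec_pi1 f)
  | |- rec (fun x => pi2 (@?f x)) => apply (rec_pi2 f)
  | |- rec (fun x => npair (@?f x) (@?g x)) => apply (rec_npair f g)
  | H : rec ?h |- rec (fun x => ?h (@?f x)) => apply (rec_comp h f H)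
  | H : rec ?h |- rec ?h => exact H
  end.

Lemma rec_add f g : rec f -> rec g -> rec (fun x => f x + g x).
Proof.
intros Hf Hg.
apply rec_ext with (fun x => nat_rect (fun _ => nat) (g x) (fun _ h => S h)
  (f x)).
{ intros x; induction (f x); simpl; auto. }
apply (rec_nat_rect g (fun _ _ h => S h)); repeat rec_tac0.
Qed.

Lemma rec_mul f g : rec f -> rec g -> rec (fun x => f x * g x).
Proof.
intros Hf Hg.
apply rec_ext with (fun x => nat_rect (fun _ => nat) 0 (fun _ h => g x + h)
  (f x)).
{ intros x; induction (f x); simpl; auto. }
apply (rec_nat_rect (fun _ => 0) (fun x _ h => g x + h)); repeat rec_tac0.
apply (rec_add (fun p => g (pi1 p))); repeat rec_tac0.
Qed.

Lemma rec_pow b f : rec f -> rec (fun x => b ^ f x).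
Proof.
intros Hf.
apply rec_ext with (fun x => nat_rect (fun _ => nat) 1 (fun _ h => b * h)
  (f x)).
{ intros x; induction (f x); simpl; auto. }
apply (rec_nat_rect (fun _ => 1) (fun x _ h => b * h)); repeat rec_tac0.
apply (rec_mul (fun _ => b)); repeat rec_tac0.
Qed.

Lemma rec_pred f : rec f -> rec (fun x => pred (f x)).
Proof.
intros Hf.
apply rec_ext with (fun x => nat_rect (fun _ => nat) 0 (fun m _ => m) (f x)).
{ intros x; now destruct (f x). }
apply (rec_nat_rect (fun _ => 0) (fun _ m _ => m)); repeat rec_tac0.
Qed.

Lemma rec_sub f g : rec f -> rec g -> rec (fun x => f x - g x).
Proof.
intros Hf Hg.
apply rec_ext with (fun x => nat_rect (fun _ => nat) (f x) (fun _ h => pred h)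
  (g x)).
{ intros x; induction (g x); simpl; lia. }
apply (rec_nat_rect f (fun _ _ h => pred h)); repeat rec_tac0.
apply rec_pred; repeat rec_tac0.
Qed.

Lemma rec_eqb f g h k : rec f -> rec g -> rec h -> rec k ->
  rec (fun x => if f x =? g x then h x else k x).
Proof.
intros Hf Hg Hh Hk.
(* The recursion depth is the sum of both truncated differences, which is 0 exactly when
   [f x = g x]. *)
apply rec_ext with (fun x => nat_rect (fun _ => nat) (h x) (fun _ _ => k x)
  ((f x - g x) + (g x - f x))).
{ intros x; destruct (Nat.eqb_spec (f x) (g x)) as [-> | H].
  - now rewrite Nat.sub_diag.
  - destruct (f x - g x + (g x - f x)) eqn:H'; simpl; [lia | trivial]. }
apply (rec_nat_rect h (fun x _ _ => k x)); repeat rec_tac0.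
apply rec_add; now apply rec_sub.
Qed.

(** * The s-m-n and recursion theorems *)

(** The s-m-n function, written arithmetically on indices so that it is visibly recursive. *)
Definition spec (e y : nat) : nat :=
  6 + 4 * npair e
    (5 + 4 * npair (encode (const_code y)) (encode id_code)).

Definition spec_code (c : code) (y : nat) : code :=
  Comp c (Pair (const_code y) id_code).

Lemma encode_spec_code c y : encode (spec_code c y) = spec (encode c) y.
Proof. reflexivity. Qed.

Lemma eval_spec_code A c y x z :
  eval A c (npair y x) z -> eval A (spec_code c y) x z.
Proof.
intros H; econstructor; [| exact H].
constructor; [apply eval_const | apply eval_id].
Qed.

Lemma rec_encode_const f : rec f -> rec (fun x => encode (const_code (f x))).
Proof.
intros Hf.
(* [6 + 4 * npair 1 h] is the index of [Comp Succ d] when [h] is the index of [d]. *)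
apply rec_ext with (fun x => nat_rect (fun _ => nat) 0
  (fun _ h => 6 + 4 * npair 1 h) (f x)).
{ intros x; induction (f x) as [|n IH]; [reflexivity |].
  cbn [nat_rect]; rewrite IH; reflexivity. }
apply (rec_nat_rect (fun _ => 0) (fun _ _ h => 6 + 4 * npair 1 h));
  repeat rec_tac0.
apply (rec_add (fun _ => 6) (fun p => 4 * npair 1 (pi2 (pi2 p))));
  repeat rec_tac0.
apply (rec_mul (fun _ => 4)); repeat rec_tac0.
Qed.

Lemma rec_spec f g : rec f -> rec g -> rec (fun x => spec (f x) (g x)).
Proof.
intros Hf Hg; unfold spec.
apply (rec_add (fun _ => 6)); repeat rec_tac0.
apply (rec_mul (fun _ => 4)); repeat rec_tac0.
apply (rec_add (fun _ => 5)); repeat rec_tac0.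
apply (rec_mul (fun _ => 4)); repeat rec_tac0.
now apply rec_encode_const.
Qed.

Ltac rec_tac :=
  repeat first
  [ rec_tac0
  | match goal with
    | |- rec (fun x => @?f x + @?g x) => apply (rec_add f g)
    | |- rec (fun x => @?f x * @?g x) => apply (rec_mul f g)
    | |- rec (fun x => ?b ^ @?f x) => apply (rec_pow b f)
    | |- rec (fun x => pred (@?f x)) => apply (rec_pred f)
    | |- rec (fun x => if @?f x =? @?g x then @?h x else @?k x) =>
        apply (rec_eqb f g h k)
    | |- rec (fun x => spec (@?f x) (@?g x)) => apply (rec_spec f g)
    | |- rec (fun x => encode (const_code (@?f x))) =>
        apply (rec_encode_const f)
    end ].

(** Kleene's diagonal: [d] specialises a given index to itself before applying [F], so [d]
    specialised to its own index feeds [F] the index of the resulting program. *)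
Lemma recursion_theorem F : rec F ->
  exists c, forall A x, eval A c x (F (npair (encode c) x)).
Proof.
intros HF.
assert (HD : rec (fun p => F (npair (spec (pi1 p) (pi1 p)) (pi2 p))))
  by rec_tac.
destruct HD as [d Hd]; exists (spec_code d (encode d)); intros A x.
apply eval_spec_code; specialize (Hd A (npair (encode d) x)).
now rewrite pi1_npair, pi2_npair in Hd.
Qed.

(* A [phi]-program runs with the empty oracle, whose answers are all 0. *)
Fixpoint no_oracle (c : code) : code :=
  match c with
  | Oracle => Zero
  | Pair c d => Pair (no_oracle c) (no_oracle d)
  | Comp c d => Comp (no_oracle c) (no_oracle d)
  | Prec c d => Prec (no_oracle c) (no_oracle d)
  | Min c => Min (no_oracle c)
  | c => c
  end.

Lemma eval_no_oracle A c x y :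
  eval (fun _ => False) c x y -> eval A (no_oracle c) x y.
Proof.
(* [eval_min] nests [eval] under an existential, where the generated induction principle gives no
   hypothesis. *)
revert c x y; fix IH 4; intros c x y H; destruct H; simpl;
  try (econstructor; eauto; fail).
- destruct H as [[[] _] | [_ ->]]; constructor.
- eapply eval_precS; [exact (IH _ _ _ H) | now apply IH].
- constructor; [now apply IH |].
  intros m Hm; destruct (H0 m Hm) as [z Hz]; exists z; now apply IH.
Qed.

Lemma computable_rec f : computable f -> rec f.
Proof.
intros [e He].
destruct (He 0) as [c [Hc _]]; exists (no_oracle c); intros A x.
destruct (He x) as [c' [Hc' H]]; rewrite <- Hc in Hc'.
apply encode_inj in Hc' as ->; now apply eval_no_oracle.
Qed.

(** * The jump on total enumerations, and the reduction of [E] to [FSjump E] *)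

Definition enumerates (e : nat) (h : nat -> nat) : Prop :=
  forall n, phi e n (h n).

Definition same_range (E : nat -> nat -> Prop) (h k : nat -> nat) : Prop :=
  (forall n, exists m, E (h n) (k m)) /\ (forall m, exists n, E (h n) (k m)).

Lemma enumerates_encode c h :
  (forall n, eval (fun _ => False) c n (h n)) -> enumerates (encode c) h.
Proof. intros H n; exists c; auto. Qed.

Lemma enumerates_spec c h y : (forall A x, eval A c x (h x)) ->
  enumerates (spec (encode c) y) (fun n => h (npair y n)).
Proof.
intros H; rewrite <- encode_spec_code; apply enumerates_encode; intros n.
now apply eval_spec_code.
Qed.

Lemma class_range_enumerates E e h C : enumerates e h ->
  class_range E e C <-> exists n, forall z, C z <-> E (h n) z.
Proof.
intros H; split.
- intros [n [y [Hy HC]]]; exists n.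
  now rewrite (Phi_fun _ _ _ _ _ (H n) Hy).
- intros [n HC]; exists n, (h n); auto.
Qed.

Lemma FSjump_enumerates E e e' h h' : Equivalence E ->
  enumerates e h -> enumerates e' h' ->
  FSjump E e e' <-> same_range E h h'.
Proof.
intros HE He He'; unfold FSjump; split.
- intros H; split; intros n.
  + destruct (proj1 (class_range_enumerates E e' h' (E (h n)) He'))
      as [m Hm].
    { apply H, (class_range_enumerates _ _ _ _ He); exists n; tauto. }
    exists m; apply Hm; reflexivity.
  + destruct (proj1 (class_range_enumerates E e h (E (h' n)) He)) as [m Hm].
    { apply H, (class_range_enumerates _ _ _ _ He'); exists n; tauto. }
    exists m; symmetry; apply Hm; reflexivity.
- intros [H1 H2] C.
  rewrite (class_range_enumerates _ _ _ _ He),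
    (class_range_enumerates _ _ _ _ He').
  split; intros [n Hn].
  + destruct (H1 n) as [m Hm]; exists m; intros z; rewrite Hn.
    split; intros Hz; [now rewrite <- Hm | now rewrite Hm].
  + destruct (H2 n) as [m Hm]; exists m; intros z; rewrite Hn.
    split; intros Hz; [now rewrite Hm | now rewrite <- Hm].
Qed.

Lemma reducible_FSjump E : Equivalence E -> reducible E (FSjump E).
Proof.
intros HE; exists (fun n => encode (const_code n)); split.
{ apply rec_computable; rec_tac. }
intros n n'.
rewrite (FSjump_enumerates E _ _ (fun _ => n) (fun _ => n') HE);
  try (apply enumerates_encode; intros; apply eval_const).
split; [intros H; now split; exists 0 | intros [H _]; now destruct (H 0)].
Qed.

(** * Consequences of a reduction of [FSjump E] to [E] *)

Lemma reduction_enumerates E f e e' h h' : Equivalence E ->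
  (forall n n', FSjump E n n' <-> E (f n) (f n')) ->
  enumerates e h -> enumerates e' h' ->
  E (f e) (f e') <-> same_range E h h'.
Proof.
intros HE f_red He He'; rewrite <- f_red; now apply FSjump_enumerates.
Qed.

(* [delta] is the image of the set of all (codes of) singletons, and [u E v]
   iff adding the pair {u, v} to this set does not change it. *)
Lemma equality_to_point E f : Equivalence E -> rec f ->
  (forall n n', FSjump E n n' <-> E (f n) (f n')) ->
  exists X delta z, rec X /\
  (forall u v, E (X (npair u v)) delta <-> E u v) /\ ~ E z delta.
Proof.
intros E_equiv rec_f f_red.
(* With parameter <u, v>, the sequence u, v, v, ... enumerates the pair {u, v}. *)
pose (h2 := fun p => if pi2 p =? 0 then pi1 (pi1 p) else pi2 (pi1 p)).
assert (R2 : rec h2) by (unfold h2; rec_tac).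
destruct R2 as [c2 H2].
assert (S2 : forall u v u' v', E (f (spec (encode c2) (npair u v)))
    (f (spec (encode c2) (npair u' v'))) <->
    same_range E (fun n => if n =? 0 then u else v)
                 (fun n => if n =? 0 then u' else v')).
{ intros u v u' v'; apply (reduction_enumerates E f); trivial.
  all: match goal with |- enumerates (spec _ ?w) _ =>
    generalize (enumerates_spec c2 h2 w H2) end; unfold enumerates, h2.
  all: intros H n; specialize (H n).
  all: now unpair in H. }
(* The code of the singleton {m}, as the pair {m, m}. *)
pose (hd := fun m => f (spec (encode c2) (npair m m))).
assert (Rd : rec hd) by (unfold hd; rec_tac).
destruct (Rd) as [cd Hd].
(* The code of {u, v} is put in front of all singleton codes, which shift by one. *)
pose (h3 := fun p => if pi2 p =? 0 then f (spec (encode c2) (pi1 p))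
                     else hd (pred (pi2 p))).
assert (R3 : rec h3) by (unfold h3; rec_tac).
destruct R3 as [c3 H3].
assert (Ed : enumerates (encode cd) hd) by (apply enumerates_encode, Hd).
(* [Min Succ] halts nowhere, so [z] is the image of the empty set, while [delta] is the image of a
   nonempty one. *)
exists (fun w => f (spec (encode c3) w)), (f (encode cd)),
  (f (encode (Min Succ))); split; [rec_tac | split].
- intros u v.
  rewrite (reduction_enumerates E f _ _ _ _ E_equiv f_red
    (enumerates_spec c3 h3 _ H3) Ed).
  unfold h3; split.
  (* Entry 0 is the code of {u, v}; it must match some singleton {m}, which makes [u] and [v] both
     equivalent to [m]. *)
  + intros [H _]; destruct (H 0) as [m Hm].
    unpair in Hm; simpl in Hm; unfold hd in Hm.
    apply S2 in Hm as [Hm _].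
    destruct (Hm 0) as [[|] Hu], (Hm 1) as [[|] Hv]; simpl in Hu, Hv;
      rewrite Hu; now symmetry.
  + intros H; split.
    * intros [|m]; rewrite pi1_npair, pi2_npair; simpl.
      -- exists u; apply S2; split; intros [|n]; exists 0; simpl;
           solve [reflexivity | now symmetry | trivial].
      -- exists m; reflexivity.
    * intros m; exists (S m); rewrite pi2_npair; reflexivity.
- rewrite <- f_red; intros H.
  destruct (proj2 (H (E (hd 0)))) as [n [y [[c [Hc Hy]] _]]].
  { apply (class_range_enumerates _ _ _ _ Ed); exists 0; tauto. }
  apply (encode_inj c (Min Succ)) in Hc as ->.
  inversion Hy as [| | | | | | | | | ? ? ? H0]; subst; inversion H0.
Qed.

(** By the recursion theorem [g] may use its own index. It is total because it only writes down
    indices of programs that call [g], without running them. *)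
Lemma recursive_equality_values E f cu cv : Equivalence E -> rec f ->
  (forall n n', FSjump E n n' <-> E (f n) (f n')) ->
  rec cu -> rec cv ->
  exists g delta, rec g /\ E (g 0) delta /\ ~ E (g 1) delta /\
    forall i, 1 < i -> E (g i) delta <->
      same_range E (fun n => g (cu (npair i n))) (fun n => g (cv (npair i n))).
Proof.
intros E_equiv rec_f f_red [ku Hu] [kv Hv].
destruct (equality_to_point E f E_equiv rec_f f_red)
  as (X & delta & z & RX & HX & Hz).
(* Here [pi1 p] is the index of [g], and each [6 + 4 * npair ...] is the index of [g] composed with
   [cu] or [cv] specialised to [i]. *)
pose (F := fun p =>
  if pi2 p =? 0 then delta else if pi2 p =? 1 then z else
  X (npair (f (6 + 4 * npair (pi1 p) (spec (encode ku) (pi2 p))))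
           (f (6 + 4 * npair (pi1 p) (spec (encode kv) (pi2 p)))))).
destruct (recursion_theorem F) as [G HG]; [unfold F; rec_tac |].
pose (g := fun i => F (npair (encode G) i)).
change (forall A x, eval A G x (g x)) in HG.
assert (A : forall c k i, (forall A x, eval A k x (c x)) ->
  enumerates (6 + 4 * npair (encode G) (spec (encode k) i))
    (fun n => g (c (npair i n)))).
{ intros c k i Hk.
  change (enumerates (encode (Comp G (spec_code k i)))
    (fun n => g (c (npair i n)))).
  apply enumerates_encode; intros n; econstructor; [| apply HG].
  now apply eval_spec_code. }
exists g, delta; split; [now exists G |].
unfold g at 1 2, F; rewrite !pi2_npair; split; [reflexivity |].
split; [exact Hz |].
intros i Hi.
rewrite <- (reduction_enumerates E f _ _ _ _ E_equiv f_red
  (A cu ku i Hu) (A cv kv i Hv)).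
unfold g at 1, F; rewrite pi1_npair, pi2_npair.
destruct i as [|[|i]]; [lia | lia | apply HX].
Qed.

(** * Infinitary formulas evaluated in [E] *)

(* Truth values of infinitary propositional formulas coded by numbers: node 0
   is true, and a node [s <> 0] is the NOR of the nodes [ch <s, n>]. *)
Inductive value (ch : nat -> nat) : bool -> nat -> Prop :=
| value_0 : value ch true 0
| value_true s : s <> 0 -> (forall n, value ch false (ch (npair s n))) ->
    value ch true s
| value_false s n : s <> 0 -> value ch true (ch (npair s n)) ->
    value ch false s.

(** The pairs <0, s> and <1, s> stand for [s] and its negation. All children are false iff their
    negations enumerate only the class of [delta]; some child is true iff adding [delta] to the
    enumeration of the children changes nothing. *)
Lemma value_reduces E f ch : Equivalence E -> rec f ->
  (forall n n', FSjump E n n' <-> E (f n) (f n')) -> rec ch ->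
  exists T delta, rec T /\ forall b s, value ch b s ->
    (E (T (npair 0 s)) delta <-> b = true) /\
    (E (T (npair 1 s)) delta <-> b = false).
Proof.
intros HE Rf Hf Rch.
destruct (recursive_equality_values E f
  (fun p => if pi1 (pi1 p) =? 0
            then npair 1 (ch (npair (pi2 (pi1 p)) (pi2 p)))
            else npair 0 (ch (npair (pi2 (pi1 p)) (pi2 p))))
  (fun p => if pi1 (pi1 p) =? 0 then 0
            else if pi2 p =? 0 then 0
            else npair 0 (ch (npair (pi2 (pi1 p)) (pred (pi2 p)))))
  HE Rf Hf)
  as (T & delta & RT & T0 & T1 & HT); [rec_tac | rec_tac |].
exists T, delta; split; [exact RT |].
(* Since <0, 0> = 0 and <1, 0> = 1, the two base values of [T] are those of node 0 and its negation;
   all other nodes obey the recursive clause. *)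
assert (Hgt : forall k s, s <> 0 -> 1 < npair k s).
{ intros k s Hs.
  assert (npair k s <> npair 0 0) by (intros K; now apply npair_inj in K).
  assert (npair k s <> npair 1 0) by (intros K; now apply npair_inj in K).
  change (npair 0 0) with 0 in *; change (npair 1 0) with 1 in *; lia. }
assert (HP : forall s, s <> 0 -> E (T (npair 0 s)) delta <->
  forall n, E (T (npair 1 (ch (npair s n)))) delta).
{ intros s Hs; rewrite (HT _ (Hgt 0 s Hs)); unfold same_range.
  split.
  - intros [H _] n; destruct (H n) as [m Hm]; revert Hm.
    unpair; simpl; intros ->; exact T0.
  - intros H; split; intros n; exists 0;
      unpair; simpl; now rewrite H. }
assert (HN : forall s, s <> 0 -> E (T (npair 1 s)) delta <->
  exists n, E (T (npair 0 (ch (npair s n)))) delta).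
{ intros s Hs; rewrite (HT _ (Hgt 1 s Hs)); unfold same_range.
  split.
  - intros [_ H]; destruct (H 0) as [n Hn]; exists n; revert Hn.
    unpair; simpl; intros ->; exact T0.
  - intros [n Hn]; split.
    + intros m; exists (S m);
        unpair; reflexivity.
    + intros [|m]; [exists n | exists m];
        unpair; simpl;
        [now rewrite Hn | reflexivity]. }
intros b s H; induction H as [| s Hs _ IH | s n Hs _ IH].
- change (npair 0 0) with 0; change (npair 1 0) with 1; intuition congruence.
- rewrite HP, HN by assumption; split; [| split; [| discriminate]].
  + split; [trivial | intros _ n; now apply IH].
  + intros [n Hn]; now apply IH in Hn.
- rewrite HP, HN by assumption; split; [split; [| discriminate] |].
  + intros H; specialize (H n); now apply IH in H.
  + split; [trivial | intros _; exists n; now apply IH].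
Qed.

(** * Formulas describing computations relative to H-sets *)

(** The successor keeps nodes apart from 0, the true formula. The tag selects the clause of [child];
    tag 0 is binary NOR, which gives negation ([s = t]) and conjunction of negated arguments. *)
Definition node (tag d : nat) : nat := S (npair tag d).
Definition nor_node (s t : nat) : nat := node 0 (npair s t).
Definition false_node : nat := nor_node 0 0.
Definition not_eval_node (b c x y : nat) : nat :=
  node 1 (npair (npair b c) (npair x y)).
Definition not_eval_pos_node (b c x : nat) : nat :=
  node 2 (npair b (npair c x)).
Definition not_H_node (b x : nat) : nat := node 3 (npair b x).
Definition min_node (b c x y : nat) : nat :=
  node 4 (npair (npair b c) (npair x y)).

(* With X the H-set H_b, the program with index [c] maps [x] to [y] with
   oracle X iff one of the nodes [witness b c x y w] is true.  The part [pi1 w]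
   guesses the immediate subprograms of [c], and [pi2 w] an intermediate
   value. *)
Definition witness (b c x y w : nat) : nat :=
  if c =? 0 then if y =? 0 then 0 else false_node
  else if c =? 1 then if y =? S x then 0 else false_node
  else if c =? 2 then if y =? pi1 x then 0 else false_node
  else if c =? 3 then if y =? pi2 x then 0 else false_node
  else if c =? 4 then
    if y =? 1 then nor_node (not_H_node b x) (not_H_node b x)
    else if y =? 0 then not_H_node b x else false_node
  else if c =? 5 + 4 * pi1 w then
    nor_node (not_eval_node b (pi1 (pi1 w)) x (pi1 y))
             (not_eval_node b (pi2 (pi1 w)) x (pi2 y))
  else if c =? 6 + 4 * pi1 w then
    nor_node (not_eval_node b (pi2 (pi1 w)) x (pi2 w))
             (not_eval_node b (pi1 (pi1 w)) (pi2 w) y)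
  else if c =? 7 + 4 * pi1 w then
    if pi2 x =? 0 then
      nor_node (not_eval_node b (pi1 (pi1 w)) (pi1 x) y)
               (not_eval_node b (pi1 (pi1 w)) (pi1 x) y)
    else
      nor_node
        (not_eval_node b c (npair (pi1 x) (pred (pi2 x))) (pi2 w))
        (not_eval_node b (pi2 (pi1 w))
           (npair (pi1 x) (npair (pred (pi2 x)) (pi2 w))) y)
  else if c =? 8 + 4 * pi1 w then min_node b (pi1 w) x y
  else false_node.

(** For tag 3, [n] guesses the shape of [b]: at a successor also an output and witness for program
    [x] on input [x], at a limit the value of the fundamental sequence, checked with the empty
    oracle H_1. For tag 4, child 0 is the zero test, and child S <m, k> treats [m] when y = m + k +
    1, that is, m < y. *)
Definition child (p : nat) : nat :=
  let tag := pi1 (pred (pi1 p)) in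
  let d := pi2 (pred (pi1 p)) in
  let n := pi2 p in
  if tag =? 0 then if n =? 0 then pi1 d else pi2 d
  else if tag =? 1 then
    witness (pi1 (pi1 d)) (pi2 (pi1 d)) (pi1 (pi2 d)) (pi2 (pi2 d)) n
  else if tag =? 2 then
    witness (pi1 d) (pi1 (pi2 d)) (pi2 (pi2 d)) (S (pi1 n)) (pi2 n)
  else if tag =? 3 then
    if pi1 d =? 2 ^ S (pi1 n) then
      witness (S (pi1 n)) (pi2 d) (pi2 d) (pi1 (pi2 n)) (pi2 (pi2 n))
    else if pi1 d =? 3 * 5 ^ pi1 n then
      nor_node (not_eval_node 1 (pi1 n) (pi2 (pi2 d)) (pi2 n))
               (not_H_node (pi2 n) (pi1 (pi2 d)))
    else false_node
  else
    if n =? 0 then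
      not_eval_node (pi1 (pi1 d)) (pi2 (pi1 d))
        (npair (pi1 (pi2 d)) (pi2 (pi2 d))) 0
    else if pi2 (pi2 d) =? S (pi1 (pred n) + pi2 (pred n)) then
      not_eval_pos_node (pi1 (pi1 d)) (pi2 (pi1 d))
        (npair (pi1 (pi2 d)) (pi1 (pred n)))
    else false_node.

Lemma rec_witness b c x y w : rec b -> rec c -> rec x -> rec y -> rec w ->
  rec (fun t => witness (b t) (c t) (x t) (y t) (w t)).
Proof.
intros; unfold witness, min_node, nor_node, not_eval_node, not_H_node, node.
rec_tac.
Qed.

Lemma rec_child : rec child.
Proof.
unfold child, nor_node, not_eval_node, not_eval_pos_node, not_H_node, node.
repeat (rec_tac; try match goal with
  |- rec (fun t => witness (@?b t) (@?c t) (@?x t) (@?y t) (@?w t)) =>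
    apply (rec_witness b c x y w) end).
Qed.

(** * Nodes that decide propositions *)

(** The two halves together ensure that the node has a truth value at all; each NOR step exchanges
    [verifies] and [refutes]. *)
Definition verifies (s : nat) (P : Prop) : Prop :=
  (P -> value child true s) /\ (~ P -> value child false s).

Definition refutes (s : nat) (P : Prop) : Prop :=
  (P -> value child false s) /\ (~ P -> value child true s).

Lemma verifies_ext s P Q : (P <-> Q) -> verifies s P -> verifies s Q.
Proof. unfold verifies; tauto. Qed.

Lemma refutes_ext s P Q : (P <-> Q) -> refutes s P -> refutes s Q.
Proof. unfold refutes; tauto. Qed.

Lemma verifies_forall tag d (P : nat -> Prop) :
  (forall n, refutes (child (npair (node tag d) n)) (P n)) ->
  verifies (node tag d) (forall n, P n).
Proof.
intros H; split; intros HP.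
- apply value_true; [discriminate | intros n; now apply H].
- apply not_all_ex_not in HP as [n Hn].
  apply value_false with n; [discriminate | now apply H].
Qed.

Lemma refutes_exists tag d (P : nat -> Prop) :
  (forall n, verifies (child (npair (node tag d) n)) (P n)) ->
  refutes (node tag d) (exists n, P n).
Proof.
intros H; split; intros HP.
- destruct HP as [n Hn].
  apply value_false with n; [discriminate | now apply H].
- apply value_true; [discriminate | intros n; apply H; eauto].
Qed.

Lemma child_nor s t n :
  child (npair (nor_node s t) n) = if n =? 0 then s else t.
Proof. unfold child, nor_node, node; now unpair; simpl; unpair. Qed.

Lemma verifies_nor s t P Q :
  refutes s P -> refutes t Q -> verifies (nor_node s t) (P /\ Q).
Proof.
intros Hs Ht.
apply verifies_ext with (forall n, if n =? 0 then P else Q).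
{ split; [intros H; exact (conj (H 0) (H 1)) | intros [HP HQ] []; trivial]. }
apply verifies_forall; intros n; fold (nor_node s t); rewrite child_nor.
now destruct n.
Qed.

Lemma value_nor_false s t : value child true s ->
  value child false (nor_node s t).
Proof.
intros H; apply value_false with 0; [discriminate |]; now rewrite child_nor.
Qed.

Lemma value_false_node : value child false false_node.
Proof. apply value_nor_false; constructor. Qed.

Lemma verifies_0 (P : Prop) : P -> verifies 0 P.
Proof. split; [constructor | contradiction]. Qed.

Lemma verifies_false (P : Prop) : ~ P -> verifies false_node P.
Proof. split; [contradiction | intros; apply value_false_node]. Qed.

Lemma refutes_false (P : Prop) : P -> refutes false_node P.
Proof. split; [intros; apply value_false_node | contradiction]. Qed.

(** * Correctness of the formulas for computations *)

(** From 5 on, the residue of [n - 5] mod 4 picks the constructor, and the quotient bounds both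
    components of its Cantor pair. So every argument of the jump is a program. *)
Lemma encode_surj n : exists c, encode c = n.
Proof.
induction n as [n IH] using lt_wf_ind.
destruct (le_lt_dec 5 n) as [L | L].
- pose proof (Nat.div_mod_eq (n - 5) 4) as Hq.
  pose proof (Nat.mod_upper_bound (n - 5) 4 ltac:(lia)) as Hr.
  revert Hq Hr; generalize ((n - 5) / 4) ((n - 5) mod 4); intros q r Hq Hr.
  pose proof (Cantor.to_nat_non_decreasing (pi1 q) (pi2 q)) as Hle.
  fold (npair (pi1 q) (pi2 q)) in Hle; pose proof (npair_pi q) as Hp.
  destruct (IH (pi1 q)) as [c Hc]; [lia |].
  destruct (IH (pi2 q)) as [d Hd]; [lia |].
  destruct (IH q) as [e He]; [lia |].
  destruct r as [|[|[|[|r]]]]; [exists (Pair c d) | exists (Comp c d)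
    | exists (Prec c d) | exists (Min e) | lia];
    cbn [encode]; rewrite ?Hc, ?Hd, ?Hp, ?He; lia.
- destruct n as [|[|[|[|[|n]]]]]; [exists Zero | exists Succ | exists Fst
    | exists Snd | exists Oracle | lia]; reflexivity.
Qed.

(** The intended meaning of [witness]: one unfolding step of [eval], with the guesses read from
    [w]. *)
Definition witness_spec (X : nat -> Prop) (c : code) (x y w : nat) : Prop :=
  match c with
  | Zero => y = 0
  | Succ => y = S x
  | Fst => y = pi1 x
  | Snd => y = pi2 x
  | Oracle => char X x y
  | Pair c d => npair (encode c) (encode d) = pi1 w /\
      eval X c x (pi1 y) /\ eval X d x (pi2 y)
  | Comp c d => npair (encode c) (encode d) = pi1 w /\
      eval X d x (pi2 w) /\ eval X c (pi2 w) y
  | Prec c' d => npair (encode c') (encode d) = pi1 w /\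
      if pi2 x =? 0 then eval X c' (pi1 x) y
      else eval X c (npair (pi1 x) (pred (pi2 x))) (pi2 w) /\
           eval X d (npair (pi1 x) (npair (pred (pi2 x)) (pi2 w))) y
  | Min c => encode c = pi1 w /\ eval X c (npair x y) 0 /\
      forall m, m < y -> exists z, eval X c (npair x m) (S z)
  end.

Lemma eval_witness_spec X c x y :
  eval X c x y <-> exists w, witness_spec X c x y w.
Proof.
split.
- intros H; destruct H; simpl.
  + now exists 0.
  + now exists 0.
  + exists 0; now unpair.
  + exists 0; now unpair.
  + now exists 0.
  + exists (npair (npair (encode c) (encode d)) 0); now unpair.
  + exists (npair (npair (encode c) (encode d)) y); now unpair.
  + exists (npair (npair (encode c) (encode d)) 0); now unpair.
  + exists (npair (npair (encode c) (encode d)) y); now unpair.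
  + exists (npair (encode c) 0); now unpair.
- intros [w H]; destruct c; simpl in H.
  + subst; constructor.
  + subst; constructor.
  + subst; apply eval_Fst.
  + subst; apply eval_Snd.
  + now constructor.
  + rewrite <- (npair_pi y); now constructor.
  + econstructor; apply H.
  + rewrite <- (npair_pi x); destruct H as [_ H].
    destruct (pi2 x) as [|n]; simpl in H; [now constructor |].
    econstructor; apply H.
  + constructor; apply H.
Qed.

Definition decides_H (b : nat) (X : nat -> Prop) : Prop :=
  forall x, refutes (not_H_node b x) (X x).

Lemma refutes_not_eval b c x y (P : nat -> Prop) :
  (forall w, verifies (witness b c x y w) (P w)) ->
  refutes (not_eval_node b c x y) (exists w, P w).
Proof.
intros H; apply refutes_exists; intros w.
unfold child, node; unpair; cbn [pred]; unpair; cbn [Nat.eqb]; unpair.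
apply H.
Qed.

Lemma refutes_not_eval_pos b c x (P : nat -> nat -> Prop) :
  (forall y w, verifies (witness b c x (S y) w) (P y w)) ->
  refutes (not_eval_pos_node b c x) (exists y w, P y w).
Proof.
intros H; apply refutes_ext with (exists p, P (pi1 p) (pi2 p)).
{ split; [intros [p Hp]; eauto |].
  intros [y [w Hw]]; exists (npair y w); now unpair. }
apply refutes_exists; intros w.
unfold child, node; unpair; cbn [pred]; unpair; cbn [Nat.eqb]; unpair.
apply H.
Qed.

(** The bounded quantifier becomes an unbounded one over pairs <m, k>; pairs with y <> m + k + 1
    contribute a false child. *)
Lemma verifies_min b c x y (P : Prop) (Q : nat -> Prop) :
  refutes (not_eval_node b c (npair x y) 0) P ->
  (forall m, m < y -> refutes (not_eval_pos_node b c (npair x m)) (Q m)) ->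
  verifies (min_node b c x y) (P /\ forall m, m < y -> Q m).
Proof.
intros HP HQ.
apply verifies_ext with (forall n, if n =? 0 then P else
  y = S (pi1 (pred n) + pi2 (pred n)) -> Q (pi1 (pred n))).
{ split.
  - intros H; split; [exact (H 0) |]; intros m Hm.
    specialize (H (S (npair m (y - S m)))); simpl in H; unpair in H.
    apply H; lia.
  - intros [H1 H2] [|n]; simpl; [trivial | intros; apply H2; lia]. }
apply verifies_forall; intros n.
unfold child, node; unpair; cbn [pred]; unpair; cbn [Nat.eqb]; unpair.
destruct n as [|n]; cbn [Nat.eqb pred]; [exact HP |].
destruct (Nat.eqb_spec y (S (pi1 n + pi2 n))) as [Hy | Hy].
- apply refutes_ext with (Q (pi1 n)); [tauto | apply HQ; lia].
- now apply refutes_false.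
Qed.

(** The offsets 5 to 8 differ mod 4, so [lia] refutes the tests for the other compound
    constructors. *)
Ltac test_index q :=
  repeat match goal with
  | |- context [?e + 4 * q =? ?k] =>
      destruct (Nat.eqb_spec (e + 4 * q) k); [try (exfalso; lia) |
        try (exfalso; lia)]
  end.

Lemma verifies_witness b X c x y w : decides_H b X ->
  verifies (witness b (encode c) x y w) (witness_spec X c x y w).
Proof.
intros HX; revert x y w.
assert (ext : forall c, (forall x y w,
    verifies (witness b (encode c) x y w) (witness_spec X c x y w)) ->
  forall x y, refutes (not_eval_node b (encode c) x y) (eval X c x y)).
{ intros d Hd x y; eapply refutes_ext;
    [symmetry; apply eval_witness_spec | apply refutes_not_eval; auto]. }
induction c as [| | | | | c IHc d IHd | c IHc d IHd | c IHc d IHd | c IHc].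
1-4: intros x y w; unfold witness; cbn [encode Nat.eqb witness_spec];
  match goal with |- context [y =? ?k] => destruct (Nat.eqb_spec y k) end;
  [now apply verifies_0 | now apply verifies_false].
- intros x y w; unfold witness; cbn [encode Nat.eqb witness_spec].
  unfold char.
  destruct (Nat.eqb_spec y 1) as [-> | H1]; [| destruct (Nat.eqb_spec y 0)
    as [-> | H0]].
  + eapply verifies_ext; [| now apply verifies_nor; apply HX].
    intuition discriminate.
  + destruct (HX x) as [K1 K2]; split; intros H.
    * apply K2; intuition discriminate.
    * apply K1, NNPP; intuition.
  + apply verifies_false; tauto.
- intros x y w; unfold witness; cbn [encode witness_spec].
  remember (npair (encode c) (encode d)) as q eqn:Hq; test_index q.
  + assert (q = pi1 w) as K by lia; rewrite <- K; subst q; unpair.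
    eapply verifies_ext; [| now apply verifies_nor; apply ext].
    tauto.
  + apply verifies_false; lia.
- intros x y w; unfold witness; cbn [encode witness_spec].
  remember (npair (encode c) (encode d)) as q eqn:Hq; test_index q.
  + assert (q = pi1 w) as K by lia; rewrite <- K; subst q; unpair.
    eapply verifies_ext; [| now apply verifies_nor; apply ext].
    tauto.
  + apply verifies_false; lia.
(* The witness for [Prec] refers to the same program at the preceding argument, hence the inner
   induction on [pi2 x]. *)
- intros x; remember (pi2 x) as n eqn:Hn; revert x Hn.
  induction n as [|n IHn]; intros x Hn y w; unfold witness;
    cbn [encode witness_spec]; rewrite <- Hn;
    remember (npair (encode c) (encode d)) as q eqn:Hq; test_index q;
    try (apply verifies_false; lia);
    assert (q = pi1 w) as K by lia; rewrite <- K; cbn [Nat.eqb pred].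
  + subst q; unpair.
    eapply verifies_ext; [| now apply verifies_nor; apply ext].
    tauto.
  + eapply verifies_ext; [| apply verifies_nor with
      (P := eval X (Prec c d) (npair (pi1 x) n) (pi2 w))].
    * split; [intros H; split; [reflexivity | exact H] | intros H; apply H].
    * eapply refutes_ext; [symmetry; apply eval_witness_spec |].
      apply refutes_not_eval; intros v; rewrite Hq.
      apply (IHn (npair (pi1 x) n)); now unpair.
    * subst q; unpair; now apply ext.
- intros x y w; unfold witness; cbn [encode witness_spec].
  remember (encode c) as q eqn:Hq; test_index q.
  + assert (q = pi1 w) as K by lia; rewrite <- K; subst q.
    eapply verifies_ext; [| apply verifies_min with
      (Q := fun m => exists z, eval X c (npair x m) (S z));
      [now apply ext |]].
    * tauto.
    * intros m _.
      apply refutes_ext with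
        (exists z v, witness_spec X c (npair x m) (S z) v).
      { split; intros [z Hz]; exists z; now apply eval_witness_spec. }
      apply refutes_not_eval_pos; auto.
  + apply verifies_false; lia.
Qed.

Lemma refutes_eval b X c x y : decides_H b X ->
  refutes (not_eval_node b (encode c) x y) (eval X c x y).
Proof.
intros HX; eapply refutes_ext; [symmetry; apply eval_witness_spec |].
apply refutes_not_eval; intros w; now apply verifies_witness.
Qed.

(** * Deciding membership in H-sets *)

Lemma child_not_H b x n : child (npair (not_H_node b x) n) =
  if b =? 2 ^ S (pi1 n) then
    witness (S (pi1 n)) x x (pi1 (pi2 n)) (pi2 (pi2 n))
  else if b =? 3 * 5 ^ pi1 n then
    nor_node (not_eval_node 1 (pi1 n) (pi2 x) (pi2 n))
             (not_H_node (pi2 n) (pi1 x))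
  else false_node.
Proof.
unfold child, not_H_node, node; unpair; cbn [pred]; unpair.
cbn [Nat.eqb]; now unpair.
Qed.

(** Parity separates successor notations 2^(k+1) from limit notations 3 * 5^e. *)
Lemma pow5_odd k : exists j, 5 ^ k = 2 * j + 1.
Proof.
induction k as [|k [j IH]]; [now exists 0 |].
exists (5 * j + 2); rewrite Nat.pow_succ_r'; lia.
Qed.

Lemma decides_H_one : decides_H 1 (fun _ => False).
Proof.
intros x; apply refutes_ext with (exists n : nat, False); [firstorder |].
apply refutes_exists; intros n; fold (not_H_node 1 x); rewrite child_not_H.
destruct (Nat.eqb_spec 1 (2 ^ S (pi1 n))) as [H | _].
{ rewrite Nat.pow_succ_r' in H; lia. }
destruct (Nat.eqb_spec 1 (3 * 5 ^ pi1 n)); [lia |].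
now apply verifies_false.
Qed.

Lemma decides_H_succ a X : a <> 0 -> decides_H a X ->
  decides_H (2 ^ a) (turing_jump X).
Proof.
intros Ha HX x; destruct (encode_surj x) as [c Hc].
(* The guess is <a - 1, <output, witness>>. *)
apply refutes_ext with (exists n, S (pi1 n) = a /\
  witness_spec X c x (pi1 (pi2 n)) (pi2 (pi2 n))).
{ split.
  - intros [n [_ H]]; exists (pi1 (pi2 n)), c; split; [exact Hc |].
    apply eval_witness_spec; eauto.
  - intros [y [c' [Hc' H]]]; rewrite <- Hc in Hc'.
    apply encode_inj in Hc' as ->; apply eval_witness_spec in H as [w Hw].
    exists (npair (pred a) (npair y w)); unpair; split; [lia | exact Hw]. }
apply refutes_exists; intros n; fold (not_H_node (2 ^ a) x).
rewrite child_not_H.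
destruct (Nat.eqb_spec (2 ^ a) (2 ^ S (pi1 n))) as [H | H].
- apply Nat.pow_inj_r in H; [subst a | lia].
  eapply verifies_ext; [| rewrite <- Hc at 1; now apply verifies_witness].
  tauto.
- destruct (Nat.eqb_spec (2 ^ a) (3 * 5 ^ pi1 n)) as [K | _].
  + destruct (pow5_odd (pi1 n)) as [j Hj]; destruct a as [|a]; [lia |].
    rewrite Hj, Nat.pow_succ_r' in K; lia.
  + apply verifies_false; intros [K _]; now subst a.
Qed.

(* In the limit case, [phi e] is evaluated as a program with oracle H_1; the
   nodes for a wrong guess of the value of [phi e] may have no truth value. *)
Lemma decides_H_lim e f X : (forall n, phi e n (f n)) ->
  (forall n, decides_H (f n) (X n)) ->
  decides_H (3 * 5 ^ e) (fun m => X (pi2 m) (pi1 m)).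
Proof.
intros Hf HX x.
apply refutes_ext with (exists n, (pi1 n = e /\ pi2 n = f (pi2 x)) /\
  X (pi2 x) (pi1 x)).
{ split; [intros [n H]; apply H |].
  intros H; exists (npair e (f (pi2 x))); now unpair. }
apply refutes_exists; intros n; fold (not_H_node (3 * 5 ^ e) x).
rewrite child_not_H.
destruct (Nat.eqb_spec (3 * 5 ^ e) (2 ^ S (pi1 n))) as [K | _].
{ destruct (pow5_odd e) as [j Hj]; rewrite Hj, Nat.pow_succ_r' in K; lia. }
destruct (Nat.eqb_spec (3 * 5 ^ e) (3 * 5 ^ pi1 n)) as [H | H].
- assert (K : 5 ^ e = 5 ^ pi1 n) by lia.
  apply Nat.pow_inj_r in K; [rewrite <- K; clear H K | lia].
  destruct (Hf (pi2 x)) as [c [<- Hc]].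
  pose proof (refutes_eval 1 _ c (pi2 x) (pi2 n) decides_H_one) as R.
  destruct (Nat.eq_dec (pi2 n) (f (pi2 x))) as [Hn | Hn].
  + rewrite Hn in R |- *.
    eapply verifies_ext; [| apply verifies_nor; [exact R | apply HX]]; tauto.
  (* A true first argument makes the NOR false whatever the second one does. *)
  + split; [tauto |]; intros _; apply value_nor_false, R.
    intros H; apply Hn; eapply eval_fun; eassumption.
- apply verifies_false; intros [[K _] _]; now subst e.
Qed.

(* Since 2 ^ 0 = 1, the number 1 would otherwise also look like a successor
   notation. *)
Lemma Hset_neq_0 a X : Hset a X -> a <> 0.
Proof.
intros [| b Y _ | e g Y _ _]; [discriminate | |].
- now apply Nat.pow_nonzero.
- pose proof (Nat.pow_nonzero 5 e); lia.
Qed.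

Lemma Hset_decides a X : Hset a X -> decides_H a X.
Proof.
intros H; induction H as [| a X H IH | e f X Hf _ IH].
- apply decides_H_one.
- apply decides_H_succ; [now apply Hset_neq_0 in H | exact IH].
- intros x; eapply refutes_ext; [| now apply (decides_H_lim e f X)].
  unfold pi1, pi2; now destruct (Cantor.of_nat x).
Qed.

(** * Diagonalisation against the jump, and the conclusion *)

(** [q] halts on [x] iff [c] outputs 0 there, [Fst] discarding the search variable; running [q] on
    its own index contradicts [c]. *)
Lemma turing_jump_not_decidable X c :
  ~ forall x y, char (turing_jump X) x y -> eval X c x y.
Proof.
intros H.
set (q := Min (Comp c Fst)).
assert (K : forall n z, eval X c (encode q) z ->
  eval X (Comp c Fst) (npair (encode q) n) z).
{ intros n z Hz; econstructor; [constructor | exact Hz]. }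
destruct (classic (turing_jump X (encode q))) as [T | T].
- pose proof (H _ 1 (or_introl (conj T eq_refl))) as H1.
  destruct T as [y [d [Hd Hy]]]; apply encode_inj in Hd as ->.
  inversion Hy as [| | | | | | | | | ? ? ? H0]; subst.
  enough (1 = 0) by discriminate.
  eapply eval_fun; [now apply K | exact H0].
- apply T; exists 0, q; split; [reflexivity |].
  apply eval_min; [| intros m Hm; lia].
  apply K, H; right; auto.
Qed.

Theorem theorem3p1 (E : nat -> nat -> Prop) (E_equiv : Equivalence E)
    (E_hyp : hyperarithmetic_rel E) :
  strictly_reducible E (FSjump E).
Proof.
split; [now apply reducible_FSjump |].
intros [f [Cf Hf]].
destruct E_hyp as (a & X & _ & HX & r & Hr).
destruct (value_reduces E f child E_equiv (computable_rec f Cf) Hf rec_child)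
  as (T & delta & RT & HT).
pose proof (Hset_decides _ _ (H_succ _ _ HX)) as D.
(* [x] lies in the jump of [X] iff this node is false, iff the pair lies in [E]; composing with [c],
   which decides [E] from [X], would decide the jump. *)
assert (R : rec (fun x => npair (T (npair 1 (not_H_node (2 ^ a) x))) delta)).
{ unfold not_H_node, node; rec_tac. }
destruct R as [d Hd], (encode_surj r) as [c Hc].
apply (turing_jump_not_decidable X (Comp c d)); intros x y Hy.
econstructor; [apply Hd |].
match goal with |- eval _ _ ?p _ => destruct (Hr p y) as [c' [Hc' He]] end.
- assert (K : E (T (npair 1 (not_H_node (2 ^ a) x))) delta <->
    turing_jump X x).
  { destruct (D x) as [D1 D2], (classic (turing_jump X x)) as [J | J].
    - destruct (HT _ _ (D1 J)) as [_ K]; tauto.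
    - destruct (HT _ _ (D2 J)) as [_ K]; intuition discriminate. }
  unfold char, npair in *; rewrite Cantor.cancel_of_to, K; exact Hy.
- rewrite <- Hc in Hc'; apply encode_inj in Hc' as ->; exact He.
Qed.
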